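(* Let $Q\subset\mathbb R^d$ be a nontrivial closed cube and $f\in\ell_\infty(Q)$. Then the two-sided inequality $$E_k(f;Q)\approx\operatorname{osc}_k(f;Q)$$ holds with equivalence constants depending only on $k,d$.
   Context: $d,k\in\mathbb N$. A closed cube is a set homothetic to $[0,1]^d$ (nontrivial: of positive sidelength). $\ell_\infty(Q)$ is the space of all bounded functions $f:Q\to\mathbb R$ (no measurability assumed). $\mathcal P_{k-1}^d$ is the space of real polynomials on $\mathbb R^d$ of degree at most $k-1$ and $E_k(f;Q):=\inf_{m\in\mathcal P_{k-1}^d}\sup_Q|f-m|$. With $\Delta_h^kf:=\sum_{j=0}^k(-1)^{k-j}\binom kj f(\cdot+jh)$, $$\operatorname{osc}_k(f;Q):=\sup_{h\in\mathbb R^d}\{|\Delta_h^kf(x)|:\ x+jh\in Q,\ j=0,\dots,k\}.$$ $A\approx B$ means $c_1A\le B\le c_2A$ with positive constants $c_1,c_2$ (here depending only on $k,d$). *)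

(* Defs.v *)
From HB Require Import structures.
From mathcomp Require Import all_boot all_order all_algebra.
From mathcomp Require Import all_classical all_reals all_analysis.
(* The notations of mpoly clash with those of MathComp-Analysis. *)
From mathcomp Require Import -(notations) mpoly.

Set Implicit Arguments.
Unset Strict Implicit.
Unset Printing Implicit Defensive.

Import Order.TTheory GRing.Theory Num.Theory.
Import numFieldNormedType.Exports.

Local Open Scope classical_set_scope.
Local Open Scope ring_scope.

Definition unit_cube (R : realType) (d : nat) : set 'rV[R]_d :=
  [set x | forall i : 'I_d, 0 <= x ord0 i <= 1].

(* Positive ratios suffice: [0,1]^d is centrally symmetric, so a homothety of
   ratio - s < 0 yields the same sets as one of ratio s. *)
Definition closed_cube (R : realType) (d : nat) (Q : set 'rV[R]_d) : Prop :=
  exists (a : 'rV[R]_d) (s : R),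
    0 < s /\ Q = [set a + s *: x | x in @unit_cube R d].

(* msize p is the total degree of p plus one, and 0 when p = 0; hence
   this is the space of polynomials of degree at most k - 1. *)
Definition polys_deg_lt (R : realType) (d k : nat) :
    set (mpoly d R) :=
  [set p : mpoly d R | (msize p <= k)%N].

Definition poly_eval (R : realType) (d : nat) (p : mpoly d R)
    (x : 'rV[R]_d) : R :=
  meval (fun i : 'I_d => x ord0 i) p.

(* Suprema and infima are taken in the extended reals, so that they are the
   genuine ones even before boundedness is known. *)
Definition best_approx (R : realType) (d k : nat)
    (f : 'rV[R]_d -> R) (Q : set 'rV[R]_d) : \bar R :=
  ereal_inf [set ereal_sup [set `|f x - poly_eval p x|%:E | x in Q]
            | p in @polys_deg_lt R d k].

Definition fin_diff (R : realType) (d k : nat) (h : 'rV[R]_d)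
    (f : 'rV[R]_d -> R) (x : 'rV[R]_d) : R :=
  \sum_(j < k.+1) (-1) ^+ (k - j) * 'C(k, j)%:R * f (x + j%:R *: h).

Definition osc (R : realType) (d k : nat)
    (f : 'rV[R]_d -> R) (Q : set 'rV[R]_d) : \bar R :=
  ereal_sup [set e | exists h x : 'rV[R]_d,
    (forall j : nat, (j <= k)%N -> Q (x + j%:R *: h)) /\
    e = `|fin_diff k h f x|%:E].

(* Main.v *)
Require Import Defs.
From HB Require Import structures.
From mathcomp Require Import all_boot all_order all_algebra.
From mathcomp Require Import all_classical all_reals all_analysis.
From mathcomp Require Import -(notations) mpoly.
From mathcomp Require Import ring lra.

Set Implicit Arguments.
Unset Strict Implicit.
Unset Printing Implicit Defensive.

Import Order.TTheory GRing.Theory Num.Theory.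
Import numFieldNormedType.Exports.

Local Open Scope classical_set_scope.
Local Open Scope ring_scope.

(** This is Whitney's theorem on local polynomial approximation, for bounded
    functions without any regularity.

    The bound of the oscillation by the approximation error is immediate: the
    k-th differences of f and of f - p agree when deg p < k, and a k-th
    difference is a combination of values whose weights have absolute sum 2^k.

    For the converse, let eps bound the k-th differences of f on the cube. A
    polynomial p of degree < k interpolates f on a small grid around the centre
    of the cube, in the sense that all mixed differences of f - p of order < k
    at the centre vanish ([newton_interpolation]). Those of order >= k are
    O(eps), because a mixed difference with k arbitrary steps is a combination
    of k-th differences with a single repeated step ([mdiff_fin_diff]); these
    reach outside the grid, but not outside the cube when the grid is small
    enough. Expanding the shifts into differences, |f - p| = O(eps) on the
    nodes. It remains to pass from the nodes to the cube, one coordinate at a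
    time ([extend_coordinate]), which is a statement about functions phi on
    [0,1] whose k-th differences are bounded by eps ([whitney_line]).

    On a line, the differences of phi are values of polynomials in the shift
    operator, and everything is read off in the ring of polynomials modulo
    (X - 1)^k. The remainder of X^n is a combination of 1, ..., X^(k-1), so that
    the values at k consecutive nodes control those at all points of the grid.
    And X - 1 itself has representatives of arbitrarily small coefficient norm
    ([Xsub1_exp_small]): with norm 1/2, this says
    |phi(y) - phi(x)| <= A eps + M / 2 for close x and y, where M is the
    supremum of |phi|. Since each point is close to the grid,
    M <= O(eps) + M / 2, and M, being finite, is O(eps). Boundedness of f is
    used there, and nothing else about f: no limit and no integral is taken. *)

(** * The algebra of difference operators *)

(** The value at index 0 of p(E) u, where E is the shift of sequences. With
    u_j = phi (t + j h), the polynomial (X - 1)^k gives the k-th difference of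
    phi with step h at t. *)
Definition act (R : nzRingType) (p : {poly R}) (u : nat -> R) : R :=
  \sum_(i < size p) p`_i * u i.

Lemma eq_act (R : nzRingType) (p : {poly R}) u v : u =1 v -> act p u = act p v.
Proof. by move=> uv; apply: eq_bigr => i _; rewrite uv. Qed.

Lemma act_widen (R : nzRingType) n (p : {poly R}) u :
  (size p <= n)%N -> act p u = \sum_(i < n) p`_i * u i.
Proof.
move=> pn; rewrite /act (big_ord_widen n (fun i => p`_i * u i) pn).
rewrite big_mkcond; apply: eq_bigr => i _; case: ltnP => // /leq_sizeP ->//.
by rewrite mul0r.
Qed.

Lemma actD (R : nzRingType) (p q : {poly R}) u :
  act (p + q) u = act p u + act q u.
Proof.
set n := maxn (size p) (size q).
rewrite !(@act_widen _ n) ?leq_maxl ?leq_maxr ?size_polyD // -big_split /=.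
by apply: eq_bigr => i _; rewrite coefD mulrDl.
Qed.

Lemma actZ (R : nzRingType) c (p : {poly R}) u : act (c *: p) u = c * act p u.
Proof.
rewrite (@act_widen _ (size p)) ?size_scale_leq // /act mulr_sumr.
by apply: eq_bigr => i _; rewrite coefZ mulrA.
Qed.

Lemma actB (R : nzRingType) (p q : {poly R}) u :
  act (p - q) u = act p u - act q u.
Proof. by rewrite -scaleN1r actD actZ mulN1r. Qed.

Lemma act_mulX (R : nzRingType) (p : {poly R}) u :
  act (p * 'X) u = act p (fun i => u i.+1).
Proof.
rewrite (@act_widen _ (size p).+1); last first.
  by rewrite (leq_trans (size_polyMleq _ _)) // size_polyX addn2.
rewrite big_ord_recl coefMX /= mul0r add0r; apply: eq_bigr => i _.
by rewrite coefMX /= add0n.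
Qed.

Lemma act_Xn (R : nzRingType) n (u : nat -> R) : act 'X^n u = u n.
Proof.
elim: n u => [|n IH] u; last by rewrite exprSr act_mulX IH.
by rewrite expr0 /act size_poly1 big_ord1 coef1 mul1r.
Qed.

(** Composition of shift operators is multiplication of polynomials: this turns
    identities in the polynomial ring into identities between differences. *)
Lemma actM (R : comNzRingType) (p q : {poly R}) u :
  act (p * q) u = act p (fun i => act q (fun j => u (i + j)%N)).
Proof.
elim/poly_ind: p u => [|p c IH] u.
  by rewrite mul0r /act size_poly0 !big_ord0.
rewrite mulrDl mul_polyC -mulrA ['X * _]mulrC mulrA !actD !act_mulX IH actZ.
congr (_ + _).
by rewrite -[c%:P]mulr1 mul_polyC actZ -(expr0 'X) act_Xn.
Qed.

Lemma act_Xsub1_exp (R : comNzRingType) k (u : nat -> R) :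
  act (('X - 1) ^+ k) u
  = \sum_(j < k.+1) (-1) ^+ (k - j) * 'C(k, j)%:R * u j.
Proof.
have E : ('X - 1 : {poly R}) ^+ k =
         \sum_(j < k.+1) ((-1) ^+ (k - j) * 'C(k, j)%:R) *: 'X^j.
  rewrite addrC exprDn; apply: eq_bigr => j _.
  rewrite -mulr_natr -mul_polyC rmorphM rmorphXn rmorphN rmorph1 rmorph_nat.
  by rewrite mulrAC.
rewrite E; elim/big_rec2: _ => [|j y1 y2 _ IH].
  by rewrite /act size_poly0 big_ord0.
by rewrite actD IH actZ act_Xn.
Qed.

Definition coef_norm (R : numDomainType) (p : {poly R}) : R := \sum_(i < size p) `|p`_i|.

Lemma coef_norm_ge0 (R : numDomainType) (p : {poly R}) : 0 <= coef_norm p.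
Proof. exact: sumr_ge0. Qed.

Lemma coef_norm_widen (R : numDomainType) n (p : {poly R}) :
  (size p <= n)%N -> coef_norm p = \sum_(i < n) `|p`_i|.
Proof.
move=> pn; rewrite /coef_norm (big_ord_widen n (fun i => `|p`_i|) pn).
rewrite big_mkcond; apply: eq_bigr => i _; case: ltnP => // /leq_sizeP ->//.
by rewrite normr0.
Qed.

Lemma coef_normD (R : numDomainType) (p q : {poly R}) :
  coef_norm (p + q) <= coef_norm p + coef_norm q.
Proof.
set n := maxn (size p) (size q).
rewrite !(@coef_norm_widen _ n) ?leq_maxl ?leq_maxr ?size_polyD // -big_split /=.
by apply: ler_sum => i _; rewrite coefD ler_normD.
Qed.

Lemma coef_normZ (R : numDomainType) c (p : {poly R}) :
  coef_norm (c *: p) = `|c| * coef_norm p.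
Proof.
rewrite (@coef_norm_widen _ (size p)) ?size_scale_leq // /coef_norm mulr_sumr.
by apply: eq_bigr => i _; rewrite coefZ normrM.
Qed.

Lemma coef_norm_cons (R : numDomainType) (p : {poly R}) c :
  coef_norm (p * 'X + c%:P) = coef_norm p + `|c|.
Proof.
rewrite (@coef_norm_widen _ (size p).+1); last first.
  rewrite (leq_trans (size_polyD _ _)) // geq_max; apply/andP; split.
    by rewrite (leq_trans (size_polyMleq _ _)) // size_polyX addn2.
  by rewrite (leq_trans (size_polyC_leq1 _)).
rewrite big_ord_recl coefD coefMX coefC /= add0r addrC; congr (_ + _).
by apply: eq_bigr => i _; rewrite coefD coefMX coefC /= addr0 add0n.
Qed.

Lemma coef_normM (R : numDomainType) (p q : {poly R}) :
  coef_norm (p * q) <= coef_norm p * coef_norm q.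
Proof.
elim/poly_ind: p => [|p c IH].
  by rewrite mul0r /coef_norm size_poly0 !big_ord0 mul0r.
rewrite mulrDl mul_polyC mulrAC (le_trans (coef_normD _ _)) //.
rewrite coef_norm_cons mulrDl coef_normZ.
by rewrite lerD2r -[_ * 'X]addr0 -polyC0 coef_norm_cons normr0 addr0 IH.
Qed.

Lemma coef_norm_exp (R : numDomainType) (p : {poly R}) n :
  coef_norm (p ^+ n) <= coef_norm p ^+ n.
Proof.
elim: n => [|n IH]; last first.
  by rewrite !exprS (le_trans (coef_normM _ _)) // ler_wpM2l // coef_norm_ge0.
by rewrite !expr0 /coef_norm size_poly1 big_ord1 coef1 normr1.
Qed.

Lemma coef_norm_Xn (R : numDomainType) n : coef_norm ('X^n : {poly R}) = 1.
Proof.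
elim: n => [|n IH].
  by rewrite !expr0 /coef_norm size_poly1 big_ord1 coef1 normr1.
by rewrite exprSr -[_ * 'X]addr0 -polyC0 coef_norm_cons IH normr0 addr0.
Qed.

Lemma ler_norm_act (R : numDomainType) (p : {poly R}) u M :
  (forall i, (i < size p)%N -> `|u i| <= M) -> `|act p u| <= coef_norm p * M.
Proof.
move=> uM; rewrite /act /coef_norm mulr_suml (le_trans (ler_norm_sum _ _ _)) //.
by apply: ler_sum => i _; rewrite normrM ler_wpM2l // uM.
Qed.

(** Modulo (X - 1)^k, each positive power of X - 1 is represented by polynomials
    of arbitrarily small coefficient norm. Descending induction on m: since
    X^n - 1 = (X - 1) (1 + ... + X^(n-1)) and the second factor is n at 1, the
    polynomial (X^n - 1)^m - n^m (X - 1)^m is a multiple of (X - 1)^(m+1), hence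
    small modulo (X - 1)^k; and n^(-m) (X^n - 1)^m has norm at most
    (2/n)^m. *)
Lemma Xsub1_exp_small (R : archiRealFieldType) k m (eta : R) :
  (0 < m)%N -> 0 < eta ->
  exists a b : {poly R}, ('X - 1) ^+ m = a * ('X - 1) ^+ k + b /\ coef_norm b <= eta.
Proof.
move: {2}(k - m)%N (leqnn (k - m)) => r.
elim: r m eta => [|r IH] m eta km m0 eta0.
  rewrite leqn0 subn_eq0 in km.
  exists (('X - 1) ^+ (m - k)), 0; rewrite addr0 -exprD subnK //; split => //.
  by rewrite /coef_norm size_poly0 big_ord0 ltW.
have [n n0 nbig] : exists2 n : nat, (0 < n)%N & 2 ^+ m / n%:R ^+ m <= eta / 2.
  exists (Num.bound (2 ^+ m * 2 / eta)).+1 => //.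
  set n := (Num.bound _).+1.
  have n1 : 1 <= n%:R :> R by rewrite ler1n.
  have h : 2 ^+ m * 2 / eta <= n%:R :> R.
    rewrite ltW // (lt_le_trans (archi_boundP _)) ?ler_nat ?leqnSn //.
    by rewrite divr_ge0 ?mulr_ge0 ?exprn_ge0 // ltW.
  rewrite ler_pdivrMr ?exprn_gt0 ?(lt_le_trans _ n1) //.
  rewrite -ler_pdivrMl ?divr_gt0 // invf_div mulrC mulrA.
  by rewrite (le_trans h) // -[leLHS]expr1 ler_weXn2l.
pose g : {poly R} := \sum_(i < n) 'X^i.
have [q Hq] : exists q, g ^+ m - (n%:R ^+ m)%:P = q * ('X - 1%:P).
  apply/factor_theorem; rewrite rootE hornerD hornerN hornerC horner_exp.
  rewrite horner_sum (eq_bigr (fun=> 1)) => [|i _]; last first.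
    by rewrite hornerXn expr1n.
  by rewrite sumr_const card_ord subrr.
pose c : R := (n%:R ^+ m)^-1.
have n00 : n%:R ^+ m != 0 :> R by rewrite expf_neq0 // pnatr_eq0 -lt0n.
have c0 : 0 < c by rewrite invr_gt0 exprn_gt0 // ltr0n.
have Hm : ('X - 1) ^+ m = c *: ('X^n - 1) ^+ m - (c *: q) * ('X - 1) ^+ m.+1.
  rewrite subrX1 -/g exprMn.
  have -> : g ^+ m = (n%:R ^+ m)%:P + q * ('X - 1).
    by rewrite -[X in q * ('X - X)]polyC1 -Hq addrC subrK.
  rewrite mulrDr scalerDr -scalerAl exprS [X in c *: X]mulrC mul_polyC scalerA.
  rewrite mulVf // scale1r [_ * (q * _)]mulrA [_ * q]mulrC -mulrA.
  by rewrite [_ ^+ m * _]mulrC addrK.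
have e0 : 0 < eta / 2 / (c * coef_norm q + 1).
  by rewrite !divr_gt0 // ltr_wpDl // mulr_ge0 ?coef_norm_ge0 // ltW.
have [||a [b [Hab Hb]]] := IH m.+1 _ _ _ e0 => //.
  by rewrite subnS; case: (k - m)%N km.
exists (- (c *: q * a)), (c *: ('X^n - 1) ^+ m - c *: q * b); split.
  by rewrite Hm Hab; ring.
have -> : eta = eta / 2 + eta / 2 by field.
rewrite (le_trans (coef_normD _ _)) // lerD //.
  rewrite coef_normZ gtr0_norm // mulrC (le_trans _ nbig) // ler_wpM2r //.
    by rewrite ltW.
  rewrite (le_trans (coef_norm_exp _ _)) // lerXn2r ?nnegrE ?coef_norm_ge0 //.
  rewrite (le_trans (coef_normD _ _)) // coef_norm_Xn -scaleN1r coef_normZ -(expr0 'X).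
  by rewrite coef_norm_Xn normrN1 mulr1.
rewrite -scaleN1r coef_normZ normrN1 mul1r (le_trans (coef_normM _ _)) //.
rewrite coef_normZ gtr0_norm //.
rewrite (le_trans (ler_wpM2l _ Hb)) ?mulr_ge0 ?coef_norm_ge0 ?(ltW c0) //.
rewrite mulrCA ler_piMr ?divr_ge0 ?(ltW eta0) // ler_pdivrMr ?mul1r ?lerDl //.
by rewrite ltr_wpDl // mulr_ge0 ?coef_norm_ge0 // ltW.
Qed.

(** * Functions on an interval *)

(** A form of Marchaud's inequality: small k-th differences make the first
    difference small up to a fraction of the supremum, provided that the
    sequence extends far enough. The factor 1/2 is what the absorption of the
    supremum in [whitney_line] needs. *)
Lemma increment_bound (R : archiRealFieldType) k :
  exists (D : nat) (A : R), 0 <= A /\ forall (u : nat -> R) (eps M : R),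
    (forall i, (i <= D)%N -> `|u i| <= M) ->
    (forall i, (i + k <= D)%N ->
      `|act (('X - 1) ^+ k) (fun j => u (i + j)%N)| <= eps) ->
    `|u 1%N - u 0%N| <= A * eps + M / 2.
Proof.
have [//|//|a [b [Hab Hb]]] := @Xsub1_exp_small R k 1 2^-1 _ _.
exists (size a + size b + k)%N, (coef_norm a); split; first exact: coef_norm_ge0.
move=> u eps M uM ueps.
have -> : u 1%N - u 0%N = act ('X - 1) u.
  by rewrite actB -(expr0 'X) -{1}(expr1 'X) !act_Xn.
have M0 : 0 <= M by rewrite (le_trans _ (uM 0%N _)).
rewrite -[_ - 1]expr1 Hab actD actM (le_trans (ler_normD _ _)) // lerD //.
  apply: ler_norm_act => i ia; apply: ueps.
  by rewrite leq_add2r (leq_trans (ltnW ia)) ?leq_addr.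
rewrite (@le_trans _ _ (coef_norm b * M)) //.
  by apply: ler_norm_act => i ib; apply: uM;
     rewrite -addnA addnCA (leq_trans (ltnW ib)) ?leq_addr.
by rewrite mulrC ler_wpM2l.
Qed.

(** Dividing X^n by (X - 1)^k leaves a remainder of degree < k, that is, a
    combination of the values at 0, ..., k - 1. *)
Lemma extrapolation_bound (R : realFieldType) k N :
  exists A : R, 0 <= A /\ forall n (u : nat -> R) (eps B : R),
    (n <= N)%N -> 0 <= eps -> 0 <= B ->
    (forall i, (i + k <= n)%N ->
      `|act (('X - 1) ^+ k) (fun j => u (i + j)%N)| <= eps) ->
    (forall j, (j < k)%N -> `|u j| <= B) ->
    `|u n| <= A * (B + eps).
Proof.
pose y : {poly R} := ('X - 1) ^+ k.
have sy : size y = k.+1 by rewrite /y -[1]/(1%:P) size_exp_XsubC.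
pose A n : R := coef_norm ('X^n %/ y) + coef_norm ('X^n %% y).
exists (\sum_(n < N.+1) A n); split.
  by apply: sumr_ge0 => n _; rewrite addr_ge0 ?coef_norm_ge0.
move=> n u eps B nN eps0 B0 ueps uB.
apply: (@le_trans _ _ (A n * (B + eps))); last first.
  rewrite ler_wpM2r ?addr_ge0 // (bigD1 (Ordinal (nN : (n < N.+1)%N))) //=.
  by rewrite lerDl sumr_ge0 // => i _; rewrite addr_ge0 ?coef_norm_ge0.
rewrite -(act_Xn n u) (divp_eq 'X^n y) actD actM (le_trans (ler_normD _ _)) //.
rewrite /A mulrDl lerD //.
  rewrite (@le_trans _ _ (coef_norm ('X^n %/ y) * eps)) //; last first.
    by rewrite ler_wpM2l ?coef_norm_ge0 // lerDr.
  apply: ler_norm_act => i; rewrite size_divp; last by rewrite -size_poly_gt0 sy.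
  by rewrite size_polyXn sy => Hi; apply: ueps; move: Hi; rewrite ltn_subRL ltnS addnC.
rewrite (@le_trans _ _ (coef_norm ('X^n %% y) * B)) //; last first.
  by rewrite ler_wpM2l ?coef_norm_ge0 // lerDl.
apply: ler_norm_act => i Hi; apply: uB.
have := ltn_modp 'X^n y; rewrite -size_poly_gt0 sy /= => h.
exact: leq_trans Hi h.
Qed.

(** The nodes start at the midpoint, so that the grid carrying them in the cube
    can be kept away from the boundary. *)
Definition nodes_control (R : realType) k (tau K : R) : Prop :=
  forall (phi : R -> R) (eps B : R),
    0 <= eps -> 0 <= B ->
    (exists M : R, forall t : R, 0 <= t <= 1 -> `|phi t| <= M) ->
    (forall t h : R, 0 <= t <= 1 -> 0 <= t + k%:R * h <= 1 ->
       `|act (('X - 1) ^+ k) (fun j => phi (t + j%:R * h))| <= eps) ->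
    (forall j, (j < k)%N -> `|phi (2^-1 + j%:R * tau)| <= B) ->
    forall t : R, 0 <= t <= 1 -> `|phi t| <= K * (B + eps).

(** Each t is at distance at most tau from a point of the grid 1/2 + tau Z, on
    its side towards the midpoint; the value there is controlled by the nodes,
    and the increment from there to t by eps and half of the supremum, which is
    then absorbed. *)
Lemma whitney_line (R : realType) k : (0 < k)%N ->
  exists tau0 : R, 0 < tau0 /\ forall tau : R, 0 < tau <= tau0 ->
  exists K : R, 0 <= K /\ nodes_control k tau K.
Proof.
move=> k0.
have [D [A [A0 HA]]] := increment_bound R k.
exists (2 * (D + k).+1%:R)^-1; split; first by rewrite invr_gt0 mulr_gt0.
move=> tau /andP[tau0 tauD].
have DN (i : nat) : (i <= D + k)%N -> i%:R * tau <= 2^-1.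
  move=> iD; have h : (D + k).+1%:R * tau <= 2^-1.
    rewrite (le_trans (ler_wpM2l _ tauD)) // invfM mulrCA divff ?mulr1 //.
  by rewrite (le_trans _ h) // ler_wpM2r ?(ltW tau0) // ler_nat leqW.
pose N := (Num.bound (2^-1 / tau) + k)%N.
have [A' [A'0 HA']] := extrapolation_bound R k N.
exists (2 * (A' + A)); split; first by rewrite mulr_ge0 // addr_ge0.
move=> phi eps B eps0 B0 [M0 HM0] Hphi HB.
(* The sequence increment_bound is applied to must stay in [0,1]: it starts
   from x or from y, whichever lets it run towards the farther endpoint. *)
have near (M x y : R) : (forall t : R, 0 <= t <= 1 -> `|phi t| <= M) ->
    0 <= x -> x <= y -> y <= 1 -> y - x <= tau ->
    `|phi y - phi x| <= A * eps + M / 2.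
  move=> HM x0 xy y1 yx.
  have iD (i : nat) : (i <= D)%N -> 0 <= i%:R * (y - x) <= 2^-1.
    move=> iD; rewrite mulr_ge0 ?subr_ge0 //=.
    rewrite (le_trans (ler_wpM2l _ yx)) // DN // (leq_trans iD) ?leq_addr //.
  have /orP[x2|x2] := le_total x 2^-1.
    have := HA (fun i => phi (x + i%:R * (y - x))) eps M.
    rewrite mul1r mul0r addr0 subrKC; apply.
      by move=> i /iD /andP[h1 h2]; apply: HM; apply/andP; split; lra.
    move=> i ikD.
    rewrite (@eq_act _ _ _ (fun j => phi ((x + i%:R * (y - x)) + j%:R * (y - x)))).
      have /andP[h1 h2] := iD i (leq_trans (leq_addr k i) ikD).
      have := iD (i + k)%N ikD; rewrite natrD mulrDl => /andP[h3 h4].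
      by apply: Hphi; apply/andP; split; lra.
    by move=> j; rewrite natrD mulrDl addrA.
  have := HA (fun i => phi (y + i%:R * (x - y))) eps M.
  rewrite mul1r mul0r addr0 subrKC distrC; apply.
    move=> i /iD /andP[]; rewrite -opprB mulrN => h1 h2.
    by apply: HM; apply/andP; split; lra.
  move=> i ikD.
  rewrite (@eq_act _ _ _ (fun j => phi ((y + i%:R * (x - y)) + j%:R * (x - y)))).
    have /andP[] := iD i (leq_trans (leq_addr k i) ikD).
    have := iD (i + k)%N ikD; rewrite -opprB !mulrN natrD mulrDl => /andP[h3 h4 h1 h2].
    by apply: Hphi; apply/andP; split; lra.
  by move=> j; rewrite natrD mulrDl addrA.
(* To the left of the midpoint the grid is run through downwards from the last
   node, so that the nodes are again the first k terms. *)
have step (M t : R) : (forall t : R, 0 <= t <= 1 -> `|phi t| <= M) ->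
    0 <= t <= 1 -> `|phi t| <= A' * (B + eps) + (A * eps + M / 2).
  move=> HM /andP[t0 t1].
  have floorP (z : R) : 0 <= z -> z <= 2^-1 ->
      exists n : nat, [/\ (n + k <= N)%N, n%:R * tau <= z & z < n%:R * tau + tau].
    move=> z0 z2; have zt : 0 <= z / tau by rewrite divr_ge0 // ltW.
    have := truncn_itv zt; set n := Num.trunc _ => /andP[h1 h2]; exists n; split.
    - rewrite /N leq_add2r ltnW //.
      rewrite -(@ltr_nat R) (le_lt_trans h1) // (@le_lt_trans _ _ (2^-1 / tau)) //.
        by rewrite ler_pM2r ?invr_gt0.
      by rewrite archi_boundP // divr_ge0 // ltW.
    - by rewrite -ler_pdivlMr.
    - by rewrite ltr_pdivrMr // -natr1 mulrDl mul1r in h2.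
  have /orP[t2|t2] := le_total 2^-1 t.
    have [|n [nN h1 h2]] := floorP (t - 2^-1) _ ltac:(lra).
      by rewrite subr_ge0.
    pose u (i : nat) := phi (2^-1 + i%:R * tau).
    have nt0 : 0 <= n%:R * tau by rewrite mulr_ge0 // ltW.
    rewrite -[phi t](subrKC (u n)) (le_trans (ler_normD _ _)) // lerD //.
      apply: HA' => //; first exact: (leq_trans (leq_addr k n) nN).
      move=> i ikn.
      rewrite (@eq_act _ _ _ (fun j => phi ((2^-1 + i%:R * tau) + j%:R * tau))).
        have h3 : 0 <= i%:R * tau by rewrite mulr_ge0 // ltW.
        have h4 : 0 <= k%:R * tau by rewrite mulr_ge0 // ltW.
        have h5 : (i + k)%:R * tau <= n%:R * tau by rewrite ler_pM2r // ler_nat.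
        rewrite natrD mulrDl in h5.
        by apply: Hphi; apply/andP; split; lra.
      by move=> j; rewrite /u natrD mulrDl addrA.
    by apply: near => //; lra.
  have [|n [nN h1 h2]] := floorP (2^-1 - t) _ ltac:(lra).
    by rewrite subr_ge0.
  pose c : R := 2^-1 + k.-1%:R * tau.
  pose u (i : nat) := phi (c + i%:R * - tau).
  have nt0 : 0 <= n%:R * tau by rewrite mulr_ge0 // ltW.
  have kt0 : 0 <= k.-1%:R * tau by rewrite mulr_ge0 // ltW.
  have kt1 : k.-1%:R * tau <= 2^-1 by rewrite DN // (leq_trans (leq_pred k)) ?leq_addl.
  have un : u (n + k.-1)%N = phi (2^-1 - n%:R * tau).
    by rewrite /u /c natrD; congr phi; ring.
  rewrite -[phi t](subrKC (u (n + k.-1)%N)) (le_trans (ler_normD _ _)) // lerD //.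
    apply: HA' => //; first by rewrite (leq_trans _ nN) // leq_add2l leq_pred.
      move=> i ikn.
      rewrite (@eq_act _ _ _ (fun j => phi ((c + i%:R * - tau) + j%:R * - tau))).
        have h3 : 0 <= i%:R * tau by rewrite mulr_ge0 // ltW.
        have h4 : 0 <= k%:R * tau by rewrite mulr_ge0 // ltW.
        have h5 : (i + k)%:R * tau <= (n + k.-1)%:R * tau.
          by rewrite ler_pM2r // ler_nat.
        rewrite !natrD !mulrDl in h5.
        by apply: Hphi; rewrite !mulrN /c; apply/andP; split; lra.
      by move=> j; rewrite /u natrD mulrDl addrA.
    move=> j jk; have -> : u j = phi (2^-1 + (k.-1 - j)%:R * tau).
      by rewrite /u /c natrB; [congr phi; ring | rewrite -ltnS prednK].
    by apply: HB; rewrite (leq_ltn_trans (leq_subr _ _)) // prednK.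
  by rewrite un distrC; apply: near => //; lra.
pose S := [set `|phi t| | t in [set t : R | 0 <= t <= 1]].
have Sub : has_sup S.
  split; first by exists `|phi 0|; exists 0 => //=; rewrite lexx ler01.
  by exists M0 => _ [t ht <-]; apply: HM0.
have HS (t : R) : 0 <= t <= 1 -> `|phi t| <= sup S.
  by move=> ht; apply: ub_le_sup; [case: Sub | exists t].
have : sup S <= A' * (B + eps) + (A * eps + sup S / 2).
  apply: sup_le_ub; first by case: Sub.
  by move=> _ [t ht <-]; apply: step.
move=> hS t ht; rewrite (le_trans (HS t ht)) //.
have : A * eps <= A * (B + eps) by rewrite ler_wpM2l // lerDr.
lra.
Qed.

(** * Mixed differences *)

Fixpoint mdiff (V W : zmodType) (hs : seq V) (f : V -> W) (x : V) : W :=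
  if hs is h :: s then mdiff s f (x + h) - mdiff s f x else f x.

Lemma eq_mdiff (V W : zmodType) (hs : seq V) (f g : V -> W) x :
  f =1 g -> mdiff hs f x = mdiff hs g x.
Proof. by move=> fg; elim: hs x => [|h s IH] x /=; rewrite ?fg ?IH. Qed.

Lemma mdiffB (V W : zmodType) (hs : seq V) (f g : V -> W) x :
  mdiff hs (fun y => f y - g y) x = mdiff hs f x - mdiff hs g x.
Proof.
by elim: hs x => [|h s IH] x //=; rewrite !IH !opprD !opprK addrACA.
Qed.

Lemma mdiff_sum (V : zmodType) (R : pzRingType) I (r : seq I) (P : pred I)
    (c : I -> R) (F : I -> V -> R) (hs : seq V) x :
  mdiff hs (fun y => \sum_(i <- r | P i) c i * F i y) x
  = \sum_(i <- r | P i) c i * mdiff hs (F i) x.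
Proof.
elim: hs x => [|h s IH] x //=; rewrite !IH -sumrB.
by apply: eq_bigr => i _; rewrite mulrBr.
Qed.

Lemma mdiff_comp (U V W : zmodType) (g : U -> V) (f : V -> W) hs x :
  {morph g : y z / y + z} -> mdiff hs (fun y => f (g y)) x = mdiff (map g hs) f (g x).
Proof. by move=> gD; elim: hs x => [|h s IH] x //=; rewrite !IH gD. Qed.

Lemma mdiff_step0 (V W : zmodType) (hs : seq V) (f : V -> W) x :
  0 \in hs -> mdiff hs f x = 0.
Proof.
elim: hs x => [|h s IH] x //=; rewrite inE => /orP[/eqP<-|h0].
  by rewrite addr0 subrr.
by rewrite !IH // subr0.
Qed.

Lemma mdiff_cat (V W : zmodType) (s1 s2 : seq V) (f : V -> W) x :
  mdiff (s1 ++ s2) f x = mdiff s1 (mdiff s2 f) x.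
Proof. by elim: s1 x => [|h s IH] x //=; rewrite !IH. Qed.

(** Difference operators commute. *)
Lemma mdiff_cat_cons (V W : zmodType) (s1 s2 : seq V) h (f : V -> W) x :
  mdiff (s1 ++ h :: s2) f x = mdiff (h :: s1 ++ s2) f x.
Proof.
rewrite !mdiff_cat /= !mdiff_cat.
by elim: s1 x => [|g s IH] x //=; rewrite !IH [x + h + g]addrAC !opprD !opprK addrACA.
Qed.

Lemma mdiff_perm (V W : zmodType) (s1 s2 : seq V) (f : V -> W) x :
  perm_eq s1 s2 -> mdiff s1 f x = mdiff s2 f x.
Proof.
elim: s1 s2 x => [|h s IH] s2 x.
  by rewrite perm_sym => /perm_nilP ->.
move=> hs; have hs2 : h \in s2 by rewrite -(perm_mem hs) mem_head.
case/splitPr: hs2 hs => p1 p2; rewrite perm_sym perm_catC /= perm_cons => hs.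
have {}hs : perm_eq s (p1 ++ p2) by rewrite perm_sym perm_catC.
by rewrite mdiff_cat_cons /= !(IH (p1 ++ p2)).
Qed.

(** The family P tracks how much room is left: P n y says that from y one may
    still add n of the steps, in any order, and stay where f is bounded. *)
Lemma ler_norm_mdiff (V : zmodType) (R : numDomainType) (P : nat -> V -> Prop)
    (hs : seq V) (f : V -> R) B x :
  (forall n y h, h \in hs -> P n.+1 y -> P n y /\ P n (y + h)) ->
  (forall y, P 0%N y -> `|f y| <= B) ->
  P (size hs) x -> `|mdiff hs f x| <= 2 ^+ size hs * B.
Proof.
move=> Ph Pf; elim: hs x Ph => [|h s IH] x Ph /= Px.
  by rewrite expr0 mul1r; apply: Pf.
have [P1 P2] := Ph _ _ h (mem_head _ _) Px.
have {}IH y : P (size s) y -> `|mdiff s f y| <= 2 ^+ size s * B.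
  by apply: IH => n z g gs; apply: Ph; rewrite inE gs orbT.
rewrite (le_trans (ler_normB _ _)) // exprS mulr_natl mulrnAl mulr2n.
by rewrite lerD // IH.
Qed.

(** Kemperman's identity: mixed differences are combinations of differences with
    a repeated step. Consider K(z, u), the k-th difference of f at z with step
    u; it is a combination of the functions f(z + i u), 0 <= i <= k. Take its
    mixed difference in the product space, with steps (h_j, - h_j / j), 1 <= j <= k. On
    f(z + i u) these act as the steps (1 - i / j) h_j, one of which is zero
    unless i = 0; and i = 0 gives the mixed difference of f. In the formula j is
    shifted by one, sequences being indexed from 0. *)
Lemma mdiff_fin_diff (R : realType) d k (hs : seq 'rV[R]_d) (f : 'rV[R]_d -> R) x :
  size hs = k ->
  mdiff hs f x = (-1) ^+ k *
    mdiff [seq (hs`_j, - (j.+1%:R^-1 *: hs`_j)) | j <- iota 0 k]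
      (fun z : 'rV[R]_d * 'rV[R]_d => fin_diff k z.2 f z.1) (x, 0).
Proof.
move=> hsk; rewrite /fin_diff.
rewrite (@mdiff_sum _ _ _ _ _ (fun j : 'I_k.+1 => (-1) ^+ (k - j) * 'C(k, j)%:R)
  (fun j z => f (z.1 + (j : nat)%:R *: z.2))).
rewrite big_ord_recl big1 ?addr0 => [|i _]; last first.
  rewrite (@mdiff_comp _ _ _ (fun z => z.1 + (lift ord0 i : nat)%:R *: z.2)).
    rewrite mdiff_step0 ?mulr0 // -map_comp; apply/mapP; exists (i : nat).
      by rewrite mem_iota add0n ltn_ord.
    by rewrite /= scalerN scalerA divff ?scale1r ?subrr // pnatr_eq0.
  by move=> y z /=; rewrite scalerDr addrACA.
rewrite subn0 bin0 mulr1 mulrA -exprD addnn -mul2n exprM sqrrN !expr1n mul1r.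
rewrite (@mdiff_comp _ _ _ (fun z => z.1 + (ord0 : 'I_k.+1)%:R *: z.2)).
  rewrite -map_comp scaler0 addr0 (@eq_map _ _ _ (nth 0 hs)); last first.
    by move=> j /=; rewrite scale0r addr0.
  by rewrite -hsk -[map _ _]/(mkseq _ _) mkseq_nth.
by move=> y z /=; rewrite !scale0r !addr0.
Qed.

(** * Newton interpolation in several variables *)

(** The generalised binomial coefficient t (t - 1) ... (t - n + 1) / n!. *)
Definition binpoly (R : fieldType) n (t : R) : R :=
  \prod_(l < n) ((t - l%:R) / l.+1%:R).

Lemma binpolyS (R : fieldType) n (t : R) :
  binpoly n.+1 t = binpoly n t * ((t - n%:R) / n.+1%:R).
Proof. by rewrite /binpoly big_ord_recr. Qed.

Lemma binpoly_pascal (R : numFieldType) n (t : R) :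
  binpoly n.+1 (t + 1) - binpoly n.+1 t = binpoly n t.
Proof.
elim: n => [|n IH].
  by rewrite !binpolyS /binpoly !big_ord0 !mul1r !divr1; ring.
rewrite binpolyS [X in _ - X]binpolyS.
have -> : binpoly n.+1 (t + 1) = binpoly n t + binpoly n.+1 t.
  by rewrite -IH subrK.
rewrite binpolyS.
have h1 : n.+1%:R != 0 :> R by rewrite pnatr_eq0.
have h2 : n.+2%:R != 0 :> R by rewrite pnatr_eq0.
have e1 : n.+1%:R = n%:R + 1 :> R by rewrite natr1.
have e2 : n.+2%:R = n%:R + 1 + 1 :> R by rewrite !natr1.
rewrite e2 e1 in h1 h2 *; field.
by rewrite h1 h2.
Qed.

Lemma binpoly0 (R : numFieldType) n : binpoly n (0 : R) = (n == 0%N)%:R.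
Proof.
case: n => [|n]; first by rewrite /binpoly big_ord0.
by rewrite /binpoly big_ord_recl subrr mul0r mul0r.
Qed.

(** Products of binomial coefficients behave under the differences with steps
    delta along the axes as monomials x^al / al! do under derivations. *)
Definition newton_fun (R : realType) d (a : 'rV[R]_d) (delta : R)
    (al : 'I_d -> nat) (x : 'rV[R]_d) : R :=
  \prod_i binpoly (al i) ((x ord0 i - a ord0 i) / delta).

Definition newton_poly (R : realType) d (a : 'rV[R]_d) (delta : R)
    (al : 'I_d -> nat) : mpoly d R :=
  \prod_i \prod_(l < al i)
    ((delta * l.+1%:R)^-1 *: (mpolyX R (mnm1 i) - mpolyC d (a ord0 i + l%:R * delta))).

Lemma poly_eval_newton (R : realType) d (a : 'rV[R]_d) (delta : R) al x :
  delta != 0 ->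
  poly_eval (newton_poly a delta al) x = newton_fun a delta al x.
Proof.
move=> delta0; rewrite /poly_eval rmorph_prod; apply: eq_bigr => i _ /=.
rewrite rmorph_prod; apply: eq_bigr => l _ /=.
rewrite mevalZ mevalB mevalXU mevalC.
by field; rewrite delta0 andbT nat1r pnatr_eq0.
Qed.

Lemma msize_prod_le (R : idomainType) d I (r : seq I) (F : I -> mpoly d R)
    (n : I -> nat) :
  (forall i, msize (F i) <= (n i).+1)%N ->
  (msize (\prod_(i <- r) F i) <= (\sum_(i <- r) n i).+1)%N.
Proof.
move=> Fn; elim/big_rec2: _ => [|i m p _ IH]; first by rewrite msize1.
have [->|F0] := eqVneq (F i) 0; first by rewrite mul0r msize0.
have [->|p0] := eqVneq p 0; first by rewrite mulr0 msize0.
by rewrite msizeM // -subn1 leq_subLR add1n -addnS -addSn leq_add.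
Qed.

Lemma msize_newton (R : realType) d (a : 'rV[R]_d) (delta : R) al :
  (msize (newton_poly a delta al) <= (\sum_i al i).+1)%N.
Proof.
apply: msize_prod_le => i.
rewrite (leq_trans (@msize_prod_le _ _ _ _ _ (fun=> 1%N) _)) //.
  move=> l; rewrite (leq_trans (msizeZ_le _ _)) //.
  rewrite (leq_trans (msizeD_le _ _)) // msizeN msizeX mdeg1 geq_max /=.
  by rewrite msizeC; case: (_ == _).
by rewrite sum1_card card_ord.
Qed.

Definition axis_step (R : realType) d (delta : R) (i : 'I_d) : 'rV[R]_d :=
  delta *: delta_mx ord0 i.

Lemma axis_stepE (R : realType) d (delta : R) (i j : 'I_d) :
  axis_step delta i ord0 j = delta * (j == i)%:R.
Proof. by rewrite !mxE eqxx. Qed.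

Lemma newton_fun_step (R : realType) d (a : 'rV[R]_d) (delta : R) al i x :
  delta != 0 ->
  newton_fun a delta al (x + axis_step delta i) - newton_fun a delta al x =
  if (0 < al i)%N then newton_fun a delta (fun j => al j - (j == i))%N x else 0.
Proof.
move=> delta0; rewrite /newton_fun (bigD1 i) // [X in _ - X](bigD1 i) //.
rewrite [X in if _ then X else _](bigD1 i) //=.
set P := \prod_(j | j != i) binpoly _ ((x ord0 j - _) / _).
have -> : \prod_(j | j != i) binpoly (al j)
    (((x + axis_step delta i) ord0 j - a ord0 j) / delta) = P.
  apply: eq_bigr => j /negbTE ji.
  by rewrite !mxE ji andbF mulr0 addr0.
have -> : \prod_(j | j != i) binpoly (al j - (j == i))
    ((x ord0 j - a ord0 j) / delta) = P.
  by apply: eq_bigr => j /negbTE ->; rewrite subn0.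
rewrite mxE axis_stepE eqxx mulr1 addrAC mulrDl divff // -mulrBl subn1.
case: (al i) => [|n] /=; last by rewrite binpoly_pascal.
by rewrite /binpoly !big_ord0 subrr mul0r.
Qed.

(** Each difference along axis i lowers the exponent of i by one, and kills the
    product once this exponent is 0. *)
Lemma mdiff_newton_fun (R : realType) d (a : 'rV[R]_d) (delta : R) al v x :
  delta != 0 ->
  mdiff (map (axis_step delta) v) (newton_fun a delta al) x =
  if [forall i, count_mem i v <= al i]%N
  then newton_fun a delta (fun j => al j - count_mem j v)%N x else 0.
Proof.
move=> delta0; elim: v x => [|i v IH] x /=.
  rewrite ifT; last by apply/forallP.
  by apply: eq_bigr => i _; rewrite subn0.
rewrite !IH; case: ifP => [/forallP h|/negP h]; last first.
  rewrite subr0 ifF //; apply/negP => /forallP h'; apply: h; apply/forallP => j.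
  by have := h' j; apply: leq_trans; rewrite leq_addl.
rewrite newton_fun_step // subn_gt0; case: ifP => hi.
  rewrite ifT.
    by apply: eq_bigr => j _; rewrite -subnDA addnC [j == i]eq_sym.
  apply/forallP => j; have := h j; case: eqP => [<-|_] //.
rewrite ifF //; apply/negP => /forallP /(_ i); rewrite eqxx add1n.
by rewrite hi.
Qed.

(** The Newton basis is dual to the mixed differences at the base point, so that
    Newton interpolation has its coefficients given by these differences. *)
Lemma mdiff_newton_fun_base (R : realType) d (a : 'rV[R]_d) (delta : R) al v :
  delta != 0 ->
  mdiff (map (axis_step delta) v) (newton_fun a delta al) a =
  [forall i, al i == count_mem i v]%:R.
Proof.
move=> delta0; rewrite mdiff_newton_fun // /newton_fun.
case: forallP => [h|h]; last first.
  case: forallP => [h'|//]; exfalso; apply: h => i; by rewrite (eqP (h' i)).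
under eq_bigr do rewrite subrr mul0r binpoly0 subn_eq0.
case: forallP => [h'|h'].
  by rewrite big1 // => i _; rewrite (eqP (h' i)) leqnn.
apply/eqP; rewrite prodf_seq_eq0; apply/hasP.
have [i /negP hi] : exists i, ~ (al i == count_mem i v).
  by apply/existsNP.
exists i; first by rewrite mem_index_enum.
by rewrite /= pnatr_eq0 eqb0 -ltnNge ltn_neqAle h eq_sym hi.
Qed.

Lemma sum_count_mem (d : nat) (v : seq 'I_d) :
  (\sum_i count_mem i v)%N = size v.
Proof.
elim: v => [|j v IH] /=; first by rewrite big1.
rewrite big_split /= IH (bigD1 j) //= eqxx big1 ?addn0 // => i /negbTE.
by rewrite eq_sym => ->.
Qed.

(** A list of axes stands for a mixed difference, or for a path on the grid; this
    is the one that uses axis i exactly n_i times. *)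
Definition word d (n : 'I_d -> nat) : seq 'I_d :=
  flatten [seq nseq (n i) i | i <- enum 'I_d].

Lemma count_word d (n : 'I_d -> nat) i : count_mem i (word n) = n i.
Proof.
rewrite count_flatten -map_comp sumnE big_map big_enum /= (bigD1 i) //=.
rewrite count_nseq /= eqxx mul1n big1 ?addn0 // => j /negbTE ji.
by rewrite count_nseq /= ji.
Qed.

(** The coefficients of p in the Newton basis are the mixed differences of f at a,
    up to order k - 1; the differences of higher order are dual to basis
    elements that do not occur in p. *)
Lemma newton_interpolation (R : realType) d k (a : 'rV[R]_d) (delta : R)
    (f : 'rV[R]_d -> R) :
  (0 < k)%N -> delta != 0 ->
  exists p : mpoly d R, (msize p <= k)%N /\ forall v,
    mdiff (map (axis_step delta) v) (poly_eval p) a =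
    if (size v < k)%N then mdiff (map (axis_step delta) v) f a else 0.
Proof.
case: k => // k _ delta0.
pose c (al : {ffun 'I_d -> 'I_k.+1}) :=
  mdiff (map (axis_step delta) (word (fun i => al i : nat))) f a.
pose P (al : {ffun 'I_d -> 'I_k.+1}) := (\sum_i al i < k.+1)%N.
exists (\sum_(al | P al) c al *: newton_poly a delta (fun i => al i : nat)); split.
  elim/big_ind: _ => [|p q hp hq|al Pal]; first by rewrite msize0.
    by rewrite (leq_trans (msizeD_le _ _)) // geq_max hp.
  rewrite (leq_trans (msizeZ_le _ _)) // (leq_trans (msize_newton _ _ _)) //.
move=> v.
rewrite (@eq_mdiff _ _ _ _
  (fun x => \sum_(al | P al) c al * newton_fun a delta (fun i => al i : nat) x)); last first.
  move=> x; rewrite /poly_eval raddf_sum; apply: eq_bigr => al _ /=.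
  by rewrite mevalZ -[meval _ _]/(poly_eval _ _) poly_eval_newton.
rewrite mdiff_sum.
under eq_bigr do rewrite mdiff_newton_fun_base //.
have sumE (al : {ffun 'I_d -> 'I_k.+1}) :
    [forall i, al i == count_mem i v :> nat] -> (\sum_i al i)%N = size v.
  by move/forallP => h; rewrite -sum_count_mem; apply: eq_bigr => i _; apply/eqP.
case: ltnP => hv; last first.
  rewrite big1 // => al; rewrite /P => Pal; case: (boolP [forall _, _]) => [/sumE h|_].
    by move: Pal; rewrite h ltnNge hv.
  by rewrite mulr0.
have cv i : (count_mem i v < k.+1)%N by rewrite (leq_ltn_trans (count_size _ _)).
pose al0 : {ffun 'I_d -> 'I_k.+1} := [ffun i => inord (count_mem i v)].
have al0E i : al0 i = count_mem i v :> nat by rewrite ffunE inordK.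
have al0P : [forall i, al0 i == count_mem i v :> nat].
  by apply/forallP => i; rewrite al0E.
have Pal0 : P al0 by rewrite /P sumE.
rewrite (bigD1 al0) //= al0P mulr1 big1 ?addr0 => [|al /andP[_ ne]].
  apply: mdiff_perm; apply: perm_map; apply/allP => i _ /=.
  by rewrite count_word al0E.
case: (boolP [forall _, _]) => [/forallP h|_]; last by rewrite mulr0.
by case/eqP: ne; apply/ffunP => i; apply/val_inj; rewrite /= al0E; apply/eqP.
Qed.

(** * Differences of polynomials *)

Lemma fin_diffE (R : realType) d k (h : 'rV[R]_d) f x :
  fin_diff k h f x = act (('X - 1) ^+ k) (fun j => f (x + j%:R *: h)).
Proof. by rewrite act_Xsub1_exp. Qed.

Lemma fin_diffB (R : realType) d k (h : 'rV[R]_d) (f g : 'rV[R]_d -> R) x :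
  fin_diff k h (fun y => f y - g y) x = fin_diff k h f x - fin_diff k h g x.
Proof. by rewrite /fin_diff -sumrB; apply: eq_bigr => j _; rewrite mulrBr. Qed.

(** The polynomial q(X + 1) - q has smaller degree than q. *)
Lemma act_Xsub1_exp_horner (R : comNzRingType) k (q : {poly R}) :
  (size q <= k)%N -> act (('X - 1) ^+ k) (fun j => q.[j%:R]) = 0.
Proof.
elim: k q => [|k IH] q qk.
  move: qk; rewrite leqn0 size_poly_eq0 => /eqP ->.
  by rewrite expr0 /act big1 // => i _; rewrite horner0 mulr0.
pose r := \sum_(i < size q) q`_i *: (('X + 1) ^+ i - 'X^i).
rewrite exprSr actM -[RHS](IH r).
  apply: eq_act => i; rewrite actB -(expr0 'X) -{1}(expr1 'X) !act_Xn addn0 addn1.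
  rewrite !(horner_coef q) -sumrB horner_sum; apply: eq_bigr => j _.
  by rewrite hornerZ hornerD hornerN !horner_exp hornerD hornerX hornerC mulrBr natr1.
rewrite (leq_trans (size_sum _ _ _)) //; apply/bigmax_leqP => i _.
rewrite (leq_trans (size_scale_leq _ _)) // subrXX addrAC subrr add0r mul1r.
rewrite (leq_trans (size_sum _ _ _)) //; apply/bigmax_leqP => j _.
rewrite (leq_trans (size_polyMleq _ _)) // size_polyXn addnS /=.
have := size_poly_exp_leq ('X + 1 : {poly R}) (i.-1 - j).
rewrite -[1]/(1%:P) size_XaddC mul1n.
move=> hs; rewrite (leq_trans (leq_add hs (leqnn j))) // addSn subnK.
  rewrite prednK ?(leq_ltn_trans _ (ltn_ord j)) //.
  by rewrite -ltnS (leq_trans (ltn_ord i)).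
by rewrite -ltnS prednK ?(leq_ltn_trans _ (ltn_ord j)).
Qed.

Lemma size_prod_poly_le (R : nzRingType) I (r : seq I) (F : I -> {poly R}) (n : I -> nat) :
  (forall i, size (F i) <= (n i).+1)%N ->
  (size (\prod_(i <- r) F i)%R <= (\sum_(i <- r) n i).+1)%N.
Proof.
move=> Fn; elim/big_rec2: _ => [|i m p _ IH]; first by rewrite size_poly1.
rewrite (leq_trans (size_polyMleq _ _)) // -subn1 leq_subLR add1n -addnS -addSn.
exact: leq_add.
Qed.

(** Restriction to a line leaves only univariate polynomials to consider in
    [fin_diff_poly]. *)
Lemma poly_eval_line (R : realType) d k (p : mpoly d R) (x h : 'rV[R]_d) :
  (msize p <= k)%N -> exists q : {poly R}, (size q <= k)%N /\
  forall t, q.[t] = poly_eval p (x + t *: h).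
Proof.
move=> pk.
exists (\sum_(m <- msupp p)
  mcoeff m p *: \prod_i ((x ord0 i)%:P + h ord0 i *: 'X) ^+ (m i)); split.
  rewrite (leq_trans (size_sum _ _ _)) //; apply/bigmax_leqP_seq => m mp _.
  rewrite (leq_trans (size_scale_leq _ _)) //.
  apply: leq_trans (leq_trans (msize_mdeg_lt mp) pk); rewrite mdegE.
  apply: size_prod_poly_le => i; rewrite (leq_trans (size_poly_exp_leq _ _)) // ltnS.
  rewrite -[leqRHS]mul1n leq_mul2r; apply/orP; right.
  rewrite -subn1 leq_subLR (leq_trans (size_polyD _ _)) //.
  rewrite geq_max (leq_trans (size_polyC_leq1 _)) //.
  by rewrite (leq_trans (size_scale_leq _ _)) // size_polyX.
move=> t; rewrite /poly_eval mevalE horner_sum; apply: eq_bigr => m _.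
rewrite hornerZ horner_prod; congr (_ * _); apply: eq_bigr => i _.
by rewrite horner_exp hornerD hornerC hornerZ hornerX !mxE mulrC.
Qed.

Lemma fin_diff_poly (R : realType) d k (p : mpoly d R) (h x : 'rV[R]_d) :
  (msize p <= k)%N -> fin_diff k h (poly_eval p) x = 0.
Proof.
move=> /(poly_eval_line x h) [q [qk qE]].
rewrite fin_diffE -(act_Xsub1_exp_horner qk).
by apply: eq_act => j; rewrite qE.
Qed.

(** * Mixed differences on a cube *)

Definition box (R : realType) d (a : 'rV[R]_d) (s : R) : set 'rV[R]_d :=
  [set x | forall i, a ord0 i <= x ord0 i <= a ord0 i + s].

Lemma closed_cube_box (R : realType) d (Q : set 'rV[R]_d) :
  closed_cube Q -> exists a s, 0 < s /\ Q = box a s.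
Proof.
move=> [a [s [s0 ->]]]; exists a, s; split => //; apply/seteqP; split => x.
  move=> [u hu <-] i; rewrite !mxE; have /andP[u0 u1] := hu i.
  by rewrite lerDl lerD2l mulr_ge0 ?(ltW s0) //= ler_piMr // ltW.
move=> hx; exists (s^-1 *: (x - a)).
  move=> i; rewrite !mxE; have /andP[u0 u1] := hx i.
  by rewrite mulr_ge0 ?invr_ge0 ?(ltW s0) ?subr_ge0 //= ler_pdivrMl // mulr1 lerBlDl.
by rewrite scalerA divff ?gt_eqF // scale1r subrKC.
Qed.

Lemma poly_eval_bounded (R : realType) d (p : mpoly d R) (a : 'rV[R]_d) s :
  exists M, forall x, box a s x -> `|poly_eval p x| <= M.
Proof.
exists (\sum_(m <- msupp p) `|mcoeff m p| * \prod_i (`|a ord0 i| + `|s|) ^+ (m i)).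
move=> x hx; rewrite /poly_eval mevalE (le_trans (ler_norm_sum _ _ _)) //.
apply: ler_sum => m _; rewrite normrM ler_wpM2l // normr_prod.
apply: ler_prod => i _; rewrite normr_ge0 normrX lerXn2r ?nnegrE ?addr_ge0 //.
have /andP[h1 h2] := hx i.
have := ler_norm (a ord0 i); have := ler_norm (- a ord0 i).
have := ler_norm s; have := normr_ge0 s; rewrite normrN.
by move=> *; rewrite ler_norml; apply/andP; split; lra.
Qed.

Definition small_diff (R : realType) d k (f : 'rV[R]_d -> R) (Q : set 'rV[R]_d)
    (eps : R) :=
  forall h x, (forall j, (j <= k)%N -> Q (x + j%:R *: h)) -> `|fin_diff k h f x| <= eps.

(** The points used by [mdiff_fin_diff] are offset from x by at most k delta per
    step in each coordinate, as |1 - i / j| <= k; hence the margin of k^2 delta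
    around x. *)
Lemma mixed_difference_bound (R : realType) d k (a : 'rV[R]_d) (s delta eps : R)
    (f : 'rV[R]_d -> R) (v : seq 'I_d) (x : 'rV[R]_d) :
  (0 < k)%N -> 0 <= delta -> small_diff k f (box a s) eps -> size v = k ->
  (forall l, `|x ord0 l - (a ord0 l + s / 2)| + k%:R * (k%:R * delta) <= s / 2) ->
  `|mdiff (map (axis_step delta) v) f x| <= 2 ^+ k * eps.
Proof.
move=> k0 delta0 Hf vk Hx.
have hsk : size (map (axis_step delta) v) = k by rewrite size_map.
rewrite (mdiff_fin_diff f x hsk) normrM normrX normrN1 expr1n mul1r.
set hs := map (axis_step delta) v; set Hs := map _ (iota 0 k).
have sHs : size Hs = k by rewrite size_map size_iota.
rewrite -[X in 2 ^+ X]sHs.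
apply: (@ler_norm_mdiff _ _ (fun n (z : 'rV[R]_d * 'rV[R]_d) => forall i l, (i <= k)%N ->
  `|z.1 ord0 l + i%:R * z.2 ord0 l - (a ord0 l + s / 2)|
    + n%:R * (k%:R * delta) <= s / 2)).
- move=> n z h /mapP[j]; rewrite mem_iota add0n => /andP[_ jk] -> Pz.
  have kd0 : 0 <= k%:R * delta by rewrite mulr_ge0.
  split=> i l ik; have := Pz i l ik; rewrite -[n.+1%:R]natr1 mulrDl mul1r.
    by apply: le_trans; lra.
  move=> Hz /=; rewrite !mxE.
  set t := hs`_j ord0 l; set b := a ord0 l + s / 2 in Hz *.
  have ht : `|t * (1 - i%:R / j.+1%:R)| <= k%:R * delta.
    rewrite normrM mulrC ler_pM //.
      have i0 : 0 <= i%:R / j.+1%:R :> R by rewrite divr_ge0.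
      have i1 : i%:R / j.+1%:R <= k%:R :> R.
        rewrite ler_pdivrMr // (@le_trans _ _ k%:R) ?ler_nat //.
        by rewrite ler_peMr // ler1n.
      have k1 : 1 <= k%:R :> R by rewrite ler1n.
      move: i0 i1; set q := i%:R / _ => i0 i1.
      by rewrite ler_norml; apply/andP; split; lra.
    have : hs`_j \in hs by rewrite mem_nth // hsk.
    case/mapP => c _; rewrite /t => ->; rewrite axis_stepE normrM ger0_norm //.
    by case: (_ == _); rewrite ?normr1 ?normr0 ?mulr1 ?mulr0.
  have -> : z.1 ord0 l + t + i%:R * (z.2 ord0 l - j.+1%:R^-1 * t) - b =
     (z.1 ord0 l + i%:R * z.2 ord0 l - b) + t * (1 - i%:R / j.+1%:R) by ring.
  have := ler_normD (z.1 ord0 l + i%:R * z.2 ord0 l - b) (t * (1 - i%:R / j.+1%:R)).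
  lra.
- move=> z Pz; apply: Hf => j jk l; have := Pz j l jk.
  rewrite mul0r addr0 ler_norml !mxE => /andP[h1 h2].
  by apply/andP; split; lra.
- by move=> i l _; rewrite sHs /= mxE mulr0 addr0; apply: Hx.
Qed.

(** A mixed difference of order at least k is a combination of differences of order
    exactly k, taken at points of the grid around the centre. *)
Lemma long_mixed_difference_bound (R : realType) d k (a : 'rV[R]_d)
    (s delta eps : R) (f : 'rV[R]_d -> R) (v : seq 'I_d) N (x : 'rV[R]_d) :
  (0 < k)%N -> 0 <= delta -> 0 <= eps -> small_diff k f (box a s) eps ->
  (forall l, x ord0 l = a ord0 l + s / 2) ->
  (k <= size v <= N)%N -> (N + k * k)%:R * delta <= s / 2 ->
  `|mdiff (map (axis_step delta) v) f x| <= 2 ^+ N * eps.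
Proof.
move=> k0 delta0 eps0 Hf Hx /andP[kv vN] HN.
rewrite -(cat_take_drop (size v - k) v) map_cat mdiff_cat.
set v1 := take _ _; set v2 := drop _ _.
have sv2 : size v2 = k by rewrite size_drop subKn.
have sv1 : size v1 = (size v - k)%N by rewrite size_takel // leq_subr.
have svs : (size v1 + k)%N = size v by rewrite sv1 subnK.
apply: (@le_trans _ _ (2 ^+ size (map (axis_step delta) v1) * (2 ^+ k * eps))).
  apply: (@ler_norm_mdiff _ _ (fun n (y : 'rV[R]_d) => forall l,
     `|y ord0 l - (a ord0 l + s / 2)| + n%:R * delta + k%:R * (k%:R * delta) <= s / 2)).
  - move=> n y h /mapP[c _ ->] Py; split=> l; have := Py l; rewrite -[n.+1%:R]natr1 mulrDl mul1r.
      lra.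
    rewrite mxE axis_stepE; set t := delta * _.
    have ht : `|t| <= delta.
      rewrite /t normrM ger0_norm //.
      by case: (_ == _); rewrite ?normr1 ?normr0 ?mulr1 ?mulr0.
    rewrite [y _ _ + t - _]addrAC.
    have := ler_normD (y ord0 l - (a ord0 l + s / 2)) t; lra.
  - move=> y Py; apply: (mixed_difference_bound k0 delta0 Hf sv2) => l.
    by have := Py l; rewrite mul0r addr0.
  - move=> l; rewrite Hx subrr normr0 add0r (le_trans _ HN) // mulrA -natrM -mulrDl -natrD.
    rewrite ler_wpM2r // ler_nat leq_add2r size_map sv1.
    by rewrite (leq_trans (leq_subr _ _)).
by rewrite size_map mulrA -exprD svs ler_wpM2r // ler_weXn2l // ler1n.
Qed.

(** Taylor expansion on a grid: a shift is the identity plus a difference, so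
    that 2^n mixed differences at x give the value n steps away. The induction
    on w needs the statement for the differences of g as well. *)
Lemma ler_norm_shift (V : zmodType) (R : numDomainType) (I : Type) (e : I -> V)
    (g : V -> R) (x : V) m B :
  (forall v, (size v <= m)%N -> `|mdiff (map e v) g x| <= B) ->
  forall w v, (size v + size w <= m)%N ->
  `|mdiff (map e v) g (x + \sum_(i <- w) e i)| <= 2 ^+ size w * B.
Proof.
move=> Hg; elim=> [|i w IH] v /=.
  by rewrite addn0 big_nil addr0 expr0 mul1r; apply: Hg.
rewrite addnS => vw; rewrite big_cons [e i + _]addrC addrA.
set y := x + _.
have -> : mdiff (map e v) g (y + e i) =
    mdiff (map e (i :: v)) g y + mdiff (map e v) g y by rewrite /= subrK.
rewrite (le_trans (ler_normD _ _)) // exprS mulr_natl mulrnAl mulr2n.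
by rewrite lerD // IH // ltnW.
Qed.

(** * From the nodes to the whole cube *)

Lemma size_word d (n : 'I_d -> nat) : size (word n) = (\sum_i n i)%N.
Proof. by rewrite -sum_count_mem; apply: eq_bigr => i _; rewrite count_word. Qed.

Lemma sum_axis_stepE (R : realType) d (delta : R) (w : seq 'I_d) l :
  (\sum_(i <- w) axis_step delta i) ord0 l = (count_mem l w)%:R * delta.
Proof.
elim: w => [|i w IH] /=; first by rewrite big_nil mxE mul0r.
by rewrite big_cons mxE IH axis_stepE natrD mulrDl [l == i]eq_sym [delta * _]mulrC.
Qed.

(** The one-dimensional theorem on the line through x parallel to axis i, whose
    nodes are the points y of the last hypothesis. As B is arbitrary, several
    coordinates can be treated one after the other. *)
Lemma extend_coordinate (R : realType) d k (tau K : R) (a : 'rV[R]_d) (s eps B : R)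
    (g : 'rV[R]_d -> R) (i : 'I_d) (x : 'rV[R]_d) :
  (0 < k)%N ->
  nodes_control k tau K ->
  k%:R * tau <= 2^-1 -> 0 < tau ->
  0 < s -> 0 <= eps -> 0 <= B ->
  (exists M, forall y, box a s y -> `|g y| <= M) ->
  small_diff k g (box a s) eps ->
  box a s x ->
  (forall y, box a s y ->
     (forall l, l != i -> y ord0 l = x ord0 l) ->
     (exists2 n, (n < k)%N & y ord0 i = a ord0 i + s / 2 + n%:R * (s * tau)) ->
     `|g y| <= B) ->
  `|g x| <= K * (B + eps).
Proof.
move=> k0 HK ktau tau0 s0 eps0 B0 [M HM] Hg bx HB.
pose L (t : R) : 'rV[R]_d := x + (a ord0 i + s * t - x ord0 i) *: delta_mx ord0 i.
have Li t : L t ord0 i = a ord0 i + s * t.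
  by rewrite !mxE !eqxx mulr1 subrKC.
have Ll t l : l != i -> L t ord0 l = x ord0 l.
  by move=> /negbTE li; rewrite !mxE li andbF mulr0 addr0.
have Lbox t : 0 <= t <= 1 -> box a s (L t).
  move=> /andP[t0 t1] l; have [->|li] := eqVneq l i; last by rewrite Ll.
  by rewrite Li lerDl lerD2l mulr_ge0 ?(ltW s0) //= ler_piMr // ltW.
have LD t h j : L (t + j * h) = L t + j *: ((s * h) *: delta_mx ord0 i).
  rewrite /L scalerA -[RHS]addrA -scalerDl; congr (_ + _ *: _); ring.
have xL : x = L ((x ord0 i - a ord0 i) / s).
  apply/rowP => l; have [->|li] := eqVneq l i; last by rewrite Ll.
  by rewrite Li mulrCA divff ?gt_eqF // mulr1 subrKC.
rewrite xL; apply: (HK (fun t => g (L t))) => //.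
- by exists M => t /Lbox; apply: HM.
- move=> t h t01 th01.
  rewrite (@eq_act _ _ _ (fun j => g (L t + j%:R *: ((s * h) *: delta_mx ord0 i)))); last first.
    by move=> j; rewrite LD.
  rewrite -fin_diffE; apply: Hg => j jk; rewrite -LD; apply: Lbox.
  (* The hypothesis only concerns the first and last of the k + 1 points; the
     others are convex combinations of them. *)
  have k00 : 0 < k%:R :> R by rewrite ltr0n.
  pose q : R := j%:R / k%:R.
  have q0 : 0 <= q by rewrite divr_ge0.
  have q1 : q <= 1 by rewrite ler_pdivrMr // mul1r ler_nat.
  have -> : t + j%:R * h = (1 - q) * t + q * (t + k%:R * h).
    by rewrite /q; field; rewrite gt_eqF.
  have /andP[u0 u1] := t01; have /andP[w0 w1] := th01.
  have q0' : 0 <= 1 - q by rewrite subr_ge0.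
  rewrite addr_ge0 ?mulr_ge0 //=.
  have := ler_wpM2l q0 w1; have := ler_wpM2l q0' u1; lra.
- move=> j jk; apply: HB.
  + apply: Lbox; have j0 : 0 <= j%:R * tau by rewrite mulr_ge0 // ltW.
    have : j%:R * tau <= k%:R * tau by rewrite ler_pM2r // ler_nat ltnW.
    by move=> h; apply/andP; split; lra.
  + by move=> l; apply: Ll.
  + by exists j => //; rewrite Li; ring.
- have /andP[h1 h2] := bx i.
  by rewrite divr_ge0 ?subr_ge0 ?(ltW s0) //= ler_pdivrMr // mul1r lerBlDl.
Qed.

(** The nodes are the points of the grid of spacing s tau based at the centre of
    the cube, with coordinates 0, ..., k - 1; they are at most d k steps away
    from the centre. After r applications of [extend_coordinate] the first r
    coordinates are free. *)
Lemma whitney_box (R : realType) d k : (0 < k)%N ->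
  exists C : R, 0 <= C /\ forall (a : 'rV[R]_d) (s eps : R) (f : 'rV[R]_d -> R),
    0 < s -> 0 <= eps -> (exists M, forall x, box a s x -> `|f x| <= M) ->
    small_diff k f (box a s) eps ->
    exists p : mpoly d R, (msize p <= k)%N /\
      forall x, box a s x -> `|f x - poly_eval p x| <= C * eps.
Proof.
move=> k0; have [tau0 [tau00 Htau]] := whitney_line R k0.
pose N := (d * k)%N.
(* The spacing leaves room for d k steps on the grid and for the margin of
   mixed_difference_bound, inside half of the cube. *)
pose tau : R := Num.min tau0 (2 * (N + k * k).+1%:R)^-1.
have taupos : 0 < tau by rewrite lt_min tau00 invr_gt0 mulr_gt0.
have room : (N + k * k)%:R * tau <= 2^-1.
  have h : (N + k * k).+1%:R * tau <= 2^-1.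
    have h' : tau <= (2 * (N + k * k).+1%:R)^-1 by rewrite ge_min lexx orbT.
    rewrite (le_trans (ler_wpM2l _ h')) // invfM mulrCA divff ?mulr1 //.
  by rewrite (le_trans _ h) // ler_wpM2r ?(ltW taupos) // ler_nat.
have ktau : k%:R * tau <= 2^-1.
  rewrite (le_trans _ room) // ler_wpM2r ?(ltW taupos) // ler_nat.
  by rewrite (leq_trans (leq_pmulr k k0)) // leq_addl.
have [|K [K0 HK]] := Htau tau; first by rewrite taupos ge_min lexx.
(* The recursion for the constant in extend_coordinate; the initial value has
   one factor from the mixed differences and one from the path to a node. *)
pose C r := iter r (fun C => K * (C + 1)) (2 ^+ N * 2 ^+ N).
have C0 r : 0 <= C r.
  elim: r => [|r IH] /=; first by rewrite mulr_ge0 ?exprn_ge0.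
  by rewrite mulr_ge0 // addr_ge0.
exists (C d); split => // a s eps f s0 eps0 [Mf HMf] Hf.
pose delta := s * tau.
have delta0 : 0 < delta by rewrite mulr_gt0.
pose c : 'rV[R]_d := \row_i (a ord0 i + s / 2).
have cE l : c ord0 l = a ord0 l + s / 2 by rewrite mxE.
have [|p [pk Hp]] := @newton_interpolation R d k c delta f k0 _.
  by rewrite gt_eqF.
exists p; split => //.
pose g x := f x - poly_eval p x; rewrite -/(g _).
have Hg : small_diff k g (box a s) eps.
  by move=> h x hx; rewrite fin_diffB fin_diff_poly // subr0; apply: Hf.
have [Mp HMp] := poly_eval_bounded p a s.
have gM : exists M, forall y, box a s y -> `|g y| <= M.
  exists (Mf + Mp) => y yb; rewrite (le_trans (ler_normB _ _)) // lerD //.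
    exact: HMf.
  exact: HMp.
have gmix v : (size v <= N)%N -> `|mdiff (map (axis_step delta) v) g c| <= 2 ^+ N * eps.
  move=> vN; rewrite mdiffB Hp; case: ltnP => kv.
    by rewrite subrr normr0 mulr_ge0 ?exprn_ge0.
  rewrite subr0; apply: (long_mixed_difference_bound k0 (ltW delta0) eps0 Hf cE).
    by rewrite kv.
  by rewrite /delta mulrCA ler_wpM2l // ltW.
suff main r : (r <= d)%N -> forall x, box a s x ->
    (forall i : 'I_d, (r <= i)%N ->
       exists2 n, (n < k)%N & x ord0 i = a ord0 i + s / 2 + n%:R * delta) ->
    `|g x| <= C r * eps.
  by move=> x bx; apply: (main d) => // i; rewrite leqNgt ltn_ord.
elim: r => [|r IH] rd x bx Hx.
  have /choice [n Hn] : forall i, exists n,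
      (n < k)%N /\ x ord0 i = a ord0 i + s / 2 + n%:R * delta.
    by move=> i; have [n] := Hx i isT; exists n.
  have -> : x = c + \sum_(i <- word n) axis_step delta i.
    by apply/rowP => l; rewrite mxE sum_axis_stepE count_word cE; case: (Hn l).
  have wN : (size (word n) <= N)%N.
    rewrite size_word /N -[X in (X * _)%N](card_ord d) -sum_nat_const.
    by apply: leq_sum => i _; case: (Hn i) => /ltnW.
  rewrite (le_trans (ler_norm_shift gmix (v := [::]) wN)) // mulrA.
  by rewrite ler_wpM2r // ler_wpM2r ?exprn_ge0 // ler_weXn2l // ler1n.
have -> : C r.+1 * eps = K * (C r * eps + eps) by rewrite /C iterS; ring.
apply: (@extend_coordinate R d k tau K a s eps _ g (Ordinal rd) x k0 HK ktau) => //.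
  by rewrite mulr_ge0.
move=> y yb yx yr; apply: IH => // [|i]; first exact: ltnW.
rewrite leq_eqVlt => /orP[/eqP ri|ri].
  by have -> : i = Ordinal rd by apply/val_inj.
rewrite yx; first exact: Hx.
by rewrite -val_eqE /= gtn_eqF.
Qed.

Theorem theorem6p1 (R : realType) (d k : nat) (hd : (0 < d)%N) (hk : (0 < k)%N) :
  exists c1 c2 : R, 0 < c1 /\ 0 < c2 /\
    forall (Q : set 'rV[R]_d) (f : 'rV[R]_d -> R),
      closed_cube Q ->
      [bounded f x | x in Q] ->
      (c1%:E * best_approx k f Q <= osc k f Q)%E /\
      (osc k f Q <= c2%:E * best_approx k f Q)%E.
Proof.
have [C [C0 HC]] := whitney_box R d hk.
(* The constant of whitney_box may be 0, and has to be inverted. *)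
have C1 : 0 < C + 1 by rewrite ltr_wpDl.
exists (C + 1)^-1, (2 ^+ k); rewrite invr_gt0 exprn_gt0 //; split => //; split => //.
move=> Q f Qcube fbd; have [a [s [s0 QE]]] := closed_cube_box Qcube.
have aQ : Q a by rewrite QE => i; rewrite lexx lerDl ltW.
have osc0 : (0 <= osc k f Q)%E.
  apply: (@le_trans _ _ `|fin_diff k 0 f a|%:E); first by rewrite lee_fin.
  apply: ereal_sup_ubound; exists 0, a; split => // j _.
  by rewrite scaler0 addr0.
split.
  rewrite lee_pdivrMl //.
  case oscE: (osc k f Q) osc0 => [eps| |] // eps0; last first.
    by rewrite gt0_muley ?lte_fin // leey.
  rewrite lee_fin in eps0.
  have [|h x hx|p [pk Hp]] := HC a s eps f s0 eps0.
  - have [M [_ HM]] := fbd; exists (M + 1) => x; rewrite -QE => Qx.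
    by apply: (HM (M + 1)) => //; rewrite ltrDl.
  - rewrite -lee_fin -oscE; apply: ereal_sup_ubound; exists h, x; split => //.
    by rewrite QE.
  apply: (@le_trans _ _ (ereal_sup [set `|f x - poly_eval p x|%:E | x in Q])).
    by apply: ereal_inf_lbound; exists p.
  apply: ge_ereal_sup => _ [x Qx <-].
  rewrite -EFinM lee_fin (le_trans (Hp x _)) -?QE //.
  by rewrite ler_wpM2r // lerDl.
rewrite -lee_pdivrMl ?exprn_gt0 //; apply: le_ereal_inf_tmp => _ [p pk <-].
rewrite lee_pdivrMl ?exprn_gt0 //.
have Hp x : Q x -> (`|f x - poly_eval p x|%:E <=
    ereal_sup [set `|f x - poly_eval p x|%:E | x in Q])%E.
  by move=> Qx; apply: ereal_sup_ubound; exists x.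
case: ereal_sup Hp => [r| |] Hp.
- apply: ge_ereal_sup => _ [h [x [hx ->]]]; rewrite -EFinM lee_fin.
  have -> : fin_diff k h f x = fin_diff k h (fun y => f y - poly_eval p y) x.
    by rewrite fin_diffB fin_diff_poly // subr0.
  rewrite /fin_diff (le_trans (ler_norm_sum _ _ _)) //.
  have -> : 2 ^+ k = \sum_(j < k.+1) 'C(k, j)%:R :> R.
    rewrite -[2]/(1 + 1) exprDn; apply: eq_bigr => j _.
    by rewrite !expr1n mul1r.
  rewrite mulr_suml; apply: ler_sum => j _.
  rewrite !normrM normrX normrN1 expr1n mul1r normr_nat ler_wpM2l //.
  by rewrite -lee_fin; apply: Hp; apply: hx; rewrite -ltnS.
- by rewrite gt0_muley ?lte_fin ?exprn_gt0 // leey.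
- by have := Hp a aQ.
Qed.
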